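(* Let $p\ge 2$ and $m\ge 1$ be integers, $\tau>0$, $\mu>0$, and $\alpha>1$ with $\alpha m/p$ an integer. Let $X_1,\dots,X_p$ be i.i.d. exponential random variables with rate $\mu$ (the initial delays of the $p$ workers). Let $T_{\text{LT}}$ and $T_{\text{ideal}}$ be the latencies of the rateless (LT) coded strategy with redundancy $\alpha$ and of the ideal load balancing strategy, respectively. Then $$\mathbb{E}[T_{\text{LT}}] - \mathbb{E}[T_{\text{ideal}}] \le \left(\tau\alpha m p^2 + \frac{p^2}{\mu} + \tau p\right)\exp\left(-\frac{\mu\tau m(\alpha-1)}{p^2}\right).$$
   Context: Setting: a matrix with $m$ rows is multiplied by a vector using $p$ workers. Delay model: worker $i$ has a random initial delay $X_i$, after which it performs row-vector product tasks one after the other, each taking time $\tau$; so it needs time $X_i+\tau b$ to complete $b$ tasks. Thus a worker that never runs out of tasks has completed $N_i(t)=\max(0,\lfloor (t-X_i)/\tau\rfloor)$ tasks by time $t$. Ideal load balancing: the $m$ tasks are kept in a central queue and each worker is given a new task as soon as it becomes available; the latency is the time at which $m$ tasks have been completed in total, i.e. $T_{\text{ideal}}=\min\{t:\sum_{i=1}^p N_i(t)\ge m\}$. Rateless (LT) coded strategy with redundancy $\alpha$: $m_e=\alpha m$ encoded rows are generated and divided equally among the $p$ workers, so each worker can complete at most $\alpha m/p$ tasks and is idle after that. The result can be decoded once the workers have collectively completed $M'$ tasks, where the decoding threshold $M'$ is taken to be equal to $m$. Hence $T_{\text{LT}}=\min\{t:\sum_{i=1}^p \min(\alpha m/p,\,N_i(t))\ge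 m\}$. *)

(* Defs.v *)
From HB Require Import structures.
From mathcomp Require Import all_boot all_order all_algebra.
From mathcomp Require Import all_classical all_reals all_analysis.

Set Implicit Arguments.
Unset Strict Implicit.
Unset Printing Implicit Defensive.

Import Order.TTheory GRing.Theory Num.Theory.

Local Open Scope classical_set_scope.
Local Open Scope ring_scope.

Section delay_model.
Context {R : realType}.
Implicit Types (p m : nat) (tau alpha t : R).

(* The number of tasks completed by time t by a worker with initial delay x
   that never runs out of tasks. *)
Definition tasks_done tau (x : R) t : int :=
  Num.max 0 (Num.floor ((t - x) / tau)).

Definition ideal_work p tau (x : 'I_p -> R) t : R :=
  \sum_(i < p) (tasks_done tau (x i) t)%:~R.

(* A worker holds alpha * m / p encoded rows and idles once they are used. *)
Definition LT_work p m tau alpha (x : 'I_p -> R) t : R :=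
  \sum_(i < p) Num.min (alpha * m%:R / p%:R) (tasks_done tau (x i) t)%:~R.

(* For the two work functions above the infimum is a minimum: see
   [ideal_latency_min] and [LT_latency_min]. *)
Definition latency m (work : R -> R) : R := inf [set t | m%:R <= work t].

Definition ideal_latency p m tau (x : 'I_p -> R) : R :=
  latency m (ideal_work tau x).

Definition LT_latency p m tau alpha (x : 'I_p -> R) : R :=
  latency m (LT_work m tau alpha x).

Definition is_minimum (A : set R) (a : R) := A a /\ lbound A a.

End delay_model.

Section random_delays.
Context {d : measure_display} {T : measurableType d} {R : realType}.
Variable P : probability T R.

Definition mutually_independent (I : finType) (X : I -> {RV P >-> R}) :=
  forall (J : {set I}) (B : I -> set R),
    (forall i, measurable (B i)) ->
    P (\bigcap_(i in [set` J]) (X i @^-1` B i)) =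
    (\prod_(i in J) P (X i @^-1` B i))%E.

(* Equality is asked on measurable sets only: the two set functions may take
   unrelated values elsewhere. *)
Definition has_exponential_distribution (mu : R) (X : {RV P >-> R}) :=
  forall B : set R, measurable B -> distribution P X B = exponential_prob mu B.

End random_delays.

Section latency_is_minimum.
Context {R : realType}.
Implicit Types (p m : nat) (tau alpha s t : R).

Definition right_locally_constant (f : R -> R) :=
  forall s, exists2 e, 0 < e & forall t, s <= t < s + e -> f t = f s.

Lemma tasks_done_right_locally_constant tau x : 0 < tau ->
  right_locally_constant (fun t => (tasks_done tau x t)%:~R).
Proof.
move=> tau0 s; set n := Num.floor ((s - x) / tau).
exists (x + (n + 1)%:~R * tau - s).
  rewrite subr_gt0 -ltrBlDl -ltr_pdivrMr//.
  exact: floorD1_gt.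
move=> t /andP[st]; rewrite addrC subrK => tlt.
congr (_%:~R); rewrite /tasks_done; congr Num.max.
apply/eqP; rewrite eq_le; apply/andP; split.
- rewrite -ltzD1 floor_lt_int ltr_pdivrMr//.
  by rewrite ltrBlDl.
- by rewrite le_floor// ler_pM2r ?invr_gt0// lerD2r.
Qed.

Lemma sum_right_locally_constant p (f : 'I_p -> R -> R) :
  (forall i, right_locally_constant (f i)) ->
  right_locally_constant (fun t => \sum_(i < p) f i t).
Proof.
move=> H s.
have /choice[e He] : forall i, exists e, 0 < e /\
    forall t, s <= t < s + e -> f i t = f i s.
  by move=> i; have [e e0 ?] := H i s; exists e.
exists (\big[Num.min/1]_(i < p) e i).
  by apply: lt_bigmin => // i _; have [] := He i.
move=> t /andP[st ts]; apply: eq_bigr => i _.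
have [_ ->//] := He i; rewrite st (lt_le_trans ts)// lerD2l.
exact: bigmin_le_cond.
Qed.

Lemma latency_min m (work : R -> R) :
  right_locally_constant work -> has_inf [set t | m%:R <= work t] ->
  is_minimum [set t | m%:R <= work t] (latency m work).
Proof.
move=> rc hi; split; last by apply: ge_inf; case: hi.
have [e e0 He] := rc (latency m work).
have [t tE te] := inf_adherent e0 hi.
rewrite /= -(He t)//; rewrite te andbT.
by apply: ge_inf => //; case: hi.
Qed.

Section bounds.
Variables (p m : nat) (tau : R) (x : 'I_p -> R).
Hypotheses (p0 : (0 < p)%N) (m0 : (0 < m)%N) (tau0 : 0 < tau).

Let lo := \big[Num.min/0]_(i < p) x i.
Let hi := \big[Num.max/0]_(i < p) x i.

Let tasks_done_lo i t : t <= lo -> tasks_done tau (x i) t = 0.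
Proof.
move=> tlo; rewrite /tasks_done; apply/max_idPl.
rewrite -ltzD1 add0r floor_lt_int mulr1z.
apply: le_lt_trans ltr01.
rewrite pmulr_lle0 ?invr_gt0// subr_le0 (le_trans tlo)//.
exact: bigmin_le_cond.
Qed.

Let tasks_done_hi i (k : nat) :
  (k%:R : R) <= (tasks_done tau (x i) (hi + tau * k%:R))%:~R.
Proof.
rewrite -[k%:R]/(k%:Z%:~R : R) ler_int /tasks_done le_max; apply/orP; right.
rewrite floor_ge_int ler_pdivlMr// mulrC lerBrDr addrC lerD2r.
exact: le_bigmax_cond.
Qed.

Lemma ideal_latency_min :
  is_minimum [set t | m%:R <= ideal_work tau x t] (ideal_latency m tau x).
Proof.
apply: latency_min.
  apply: sum_right_locally_constant => i.
  exact: tasks_done_right_locally_constant.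
split.
  exists (hi + tau * m%:R) => /=; rewrite /ideal_work.
  rewrite (bigD1 (Ordinal p0))//= -[leLHS]addr0; apply: lerD.
    exact: tasks_done_hi.
  by apply: sumr_ge0 => i _; rewrite ler0z le_max lexx.
exists lo => t /= mt; rewrite leNgt; apply/negP => /ltW tlo.
move: mt; rewrite /ideal_work big1 => [|i _]; last by rewrite tasks_done_lo.
by rewrite lern0 eqn0Ngt m0.
Qed.

Lemma LT_latency_min alpha : 1 < alpha ->
  is_minimum [set t | m%:R <= LT_work m tau alpha x t]
             (LT_latency m tau alpha x).
Proof.
move=> alpha1.
have c0 : 0 <= alpha * m%:R / p%:R.
  by rewrite divr_ge0// mulr_ge0// (le_trans ler01)// ltW.
apply: latency_min.
  apply: sum_right_locally_constant => i s.
  have [e e0 He] := tasks_done_right_locally_constant (x i) tau0 s.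
  by exists e => // t /He ->.
split.
  pose k := (Num.truncn (alpha * m%:R / p%:R)).+1.
  exists (hi + tau * k%:R) => /=; rewrite /LT_work.
  have ck : alpha * m%:R / p%:R <= k%:R by rewrite ltW// truncnS_gt.
  under eq_bigr => i _ do rewrite (min_idPl (le_trans ck (tasks_done_hi i k))).
  rewrite sumr_const card_ord -[leRHS]mulr_natr divfK ?pnatr_eq0 -?lt0n//.
  by rewrite ler_peMl// ltW.
exists lo => t /= mt; rewrite leNgt; apply/negP => /ltW tlo.
move: mt; rewrite /LT_work big1 => [|i _].
  by rewrite lern0 eqn0Ngt m0.
by rewrite tasks_done_lo// (min_idPr c0).
Qed.

End bounds.
End latency_is_minimum.

(* Main.v *)
(* Let k = alpha m / p and a = tau m (alpha - 1) / p^2. The two latencies differ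
   only if, under ideal load balancing, some worker completes more than k tasks,
   so that T_ideal >= tau (k + 1), while T_LT <= max_j X_j + tau k always holds;
   hence T_LT - T_ideal <= max_j X_j. In that case some delay must exceed a, for
   otherwise every other worker would be close to k tasks by then and all m tasks
   would have been completed earlier. So almost surely T_LT - T_ideal is at most
   \sum_j X_j 1_{X_j > a}, of expectation p (a + 1 / mu) exp(- mu a). *)

Require Import Defs.
From HB Require Import structures.
From mathcomp Require Import all_boot all_order all_algebra.
From mathcomp Require Import all_classical all_reals all_analysis.
From mathcomp Require Import measurable_realfun ring lra.

Import Order.TTheory GRing.Theory Num.Theory.
Local Open Scope classical_set_scope.
Local Open Scope ring_scope.

(** * Task counts of a single worker *)

Section tasks_done.
Context {R : realType}.
Variable tau : R.
Hypothesis tau0 : 0 < tau.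

Lemma tasks_done_ge (k : nat) (x t : R) :
  x + tau * k%:R <= t -> k%:R <= (tasks_done tau x t)%:~R :> R.
Proof.
move=> xt; rewrite -[k%:R]/(k%:Z%:~R : R) ler_int le_max floor_ge_int.
by apply/orP; right; rewrite ler_pdivlMr// mulrC lerBrDl.
Qed.

(** Counts are integers, so more than [k] means at least [k + 1]. The extra [tau] gained here is
    what lets a worker still have [k] tasks slightly before [t]. *)
Lemma tasks_done_gt (k : nat) (x t : R) :
  k%:R < (tasks_done tau x t)%:~R :> R -> x + tau * k.+1%:R <= t.
Proof.
rewrite -[k%:R]/(k%:Z%:~R : R) ltr_int lt_max ltNge lez_nat leq0n /=.
rewrite -lezD1 floor_ge_int ler_pdivlMr// lerBrDl mulrC.
by rewrite -[(_ + 1)%R]/(k + 1)%N%:Z addn1.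
Qed.

Lemma tasks_done_gtB1 (x t : R) :
  (t - x) / tau - 1 <= (tasks_done tau x t)%:~R.
Proof.
have := ltW (floorD1_gt ((t - x) / tau)).
rewrite intrD -lerBlDr => /le_trans; apply.
by rewrite ler_int le_max lexx orbT.
Qed.

Lemma tasks_done_eq0 (x t : R) : t <= x -> tasks_done tau x t = 0.
Proof.
move=> tx; apply/max_idPl; rewrite floor_le0 (le_lt_trans _ ltr01)//.
by rewrite pmulr_lle0 ?invr_gt0// subr_le0.
Qed.

Lemma tasks_done_homo (x : R) : {homo tasks_done tau x : s t / s <= t}.
Proof.
move=> s t st; rewrite ge_max !le_max lexx/=; apply/orP; right.
by rewrite le_floor// ler_pM2r ?invr_gt0// lerD2r.
Qed.

Lemma measurable_tasks_done (t : R) :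
  measurable_fun [set: R] (fun x => (tasks_done tau x t)%:~R : R).
Proof.
apply: nonincreasing_measurable => // x y xy.
rewrite ler_int ge_max !le_max lexx/=; apply/orP; right.
by rewrite le_floor// ler_pM2r ?invr_gt0// lerD2l lerN2.
Qed.

End tasks_done.

(* [x] if [a < x] and [0] otherwise, split so that both terms have an expectation
   given by the complementary distribution function of [x]. *)
Definition tail_part {R : realType} (a x : R) : R :=
  a * \1_`]a, +oo[ x + Num.max 0 (x - a).

Lemma tail_part_gt {R : realType} (a x : R) : a < x -> tail_part a x = x.
Proof.
move=> ax; rewrite /tail_part indicE mem_set/= ?in_itv/= ?ax//.
by rewrite mulr1 max_r ?subr_ge0 1?ltW// addrC subrK.
Qed.

Lemma tail_part_ge0 {R : realType} (a x : R) : 0 <= a -> 0 <= tail_part a x.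
Proof. by move=> a0; rewrite addr_ge0 ?mulr_ge0 ?le_max ?lexx. Qed.

(** * Comparison of the two latencies for fixed delays *)

Section latency.
Context {R : realType}.
Variables (p m k : nat) (tau alpha : R) (x : 'I_p -> R).
Hypotheses (p0 : (0 < p)%N) (m0 : (0 < m)%N) (tau0 : 0 < tau).
Hypotheses (alpha1 : 1 < alpha) (alphak : alpha * m%:R / p%:R = k%:R).

Lemma ideal_work_homo : {homo ideal_work tau x : s t / s <= t}.
Proof.
by move=> s t st; apply: ler_sum => i _; rewrite ler_int tasks_done_homo.
Qed.

Lemma LT_work_homo : {homo LT_work m tau alpha x : s t / s <= t}.
Proof.
move=> s t st; apply: ler_sum => i _; rewrite le_min !ge_min lexx/=.
by rewrite ler_int tasks_done_homo// orbT.
Qed.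

(** The infimum is attained and the work is nondecreasing. Comparisons of latencies thus become
    comparisons of work at a fixed time. *)
Lemma ideal_latency_leE t :
  (ideal_latency m tau x <= t) = (m%:R <= ideal_work tau x t).
Proof.
have [wl lb] := ideal_latency_min x p0 m0 tau0.
apply/idP/idP => [lt|]; last exact: lb.
exact: le_trans wl (ideal_work_homo _ _ lt).
Qed.

Lemma LT_latency_leE t :
  (LT_latency m tau alpha x <= t) = (m%:R <= LT_work m tau alpha x t).
Proof.
have [wl lb] := LT_latency_min x p0 m0 tau0 alpha1.
apply/idP/idP => [lt|]; last exact: lb.
exact: le_trans wl (LT_work_homo _ _ lt).
Qed.

Lemma ideal_le_LT_latency : ideal_latency m tau x <= LT_latency m tau alpha x.
Proof.
rewrite ideal_latency_leE.
apply: (@le_trans _ _ (LT_work m tau alpha x (LT_latency m tau alpha x))).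
  by rewrite -LT_latency_leE.
by apply: ler_sum => i _; rewrite ge_min lexx orbT.
Qed.

Lemma ideal_latency_ge y : (forall i, y <= x i) -> y <= ideal_latency m tau x.
Proof.
move=> yx; rewrite leNgt; apply/negP => /ltW.
rewrite ideal_latency_leE /ideal_work big1 => [|i _].
  by rewrite lern0 eqn0Ngt m0.
by rewrite tasks_done_eq0.
Qed.

(** By time [y + tau * k] every worker has used up its [k] rows, and [p * k = alpha * m] is at least
    [m]. *)
Lemma LT_latency_le y :
  (forall i, x i <= y) -> LT_latency m tau alpha x <= y + tau * k%:R.
Proof.
move=> xy; rewrite LT_latency_leE /LT_work alphak.
rewrite (eq_bigr (fun=> k%:R)) => [|i _].
  rewrite sumr_const card_ord -[leRHS]mulr_natr -alphak.
  by rewrite divfK ?pnatr_eq0 -?lt0n// ler_peMl// ltW.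
by apply/min_idPl/tasks_done_ge => //; rewrite lerD2r.
Qed.

Let a := tau * m%:R * (alpha - 1) / p%:R ^+ 2.

(* Were all delays at most [a], then slightly before the time [t] at which
   worker [i] completes [k + 1] tasks the other workers would have supplied the
   missing [m - k] tasks. *)
Lemma ideal_work_before i t : (forall j, 0 <= x j <= a) ->
  x i + tau * k.+1%:R <= t -> exists2 s, s < t & m%:R <= ideal_work tau x s.
Proof.
move=> xa xit; have pR : 0 < p%:R :> R by rewrite ltr0n.
have mR : 0 < m%:R :> R by rewrite ltr0n.
have a0 : 0 < a by rewrite divr_gt0 ?exprn_gt0 ?mulr_gt0 ?subr_gt0.
(* [e <= tau] leaves worker [i] with [k] tasks at time [t - e]; [e <= a] makes the step back cost
   the others no more than one further delay [a]. *)
pose e := Num.min tau a.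
have e0 : 0 < e by rewrite lt_min tau0.
exists (t - e); first by rewrite ltrBlDr ltrDl.
have xi0 : 0 <= x i by have /andP[] := xa i.
rewrite /ideal_work (bigD1 i)//=.
have ki : k%:R <= (tasks_done tau (x i) (t - e))%:~R :> R.
  apply: tasks_done_ge => //.
  have : e <= tau by rewrite ge_min lexx.
  by move: xit; rewrite -natr1; lra.
(* Another worker loses at most [2 * a] of working time, once for its delay and once for [e]; the
   task lost to rounding down is paid for by the [tau] in [tau * k.+1]. *)
apply: le_trans (lerD ki (_ : \sum_(j < p | j != i) (k%:R - 2 * a / tau) <= _)).
  rewrite sumr_const cardC1 card_ord -[X in _ <= _ + X]mulr_natr.
  rewrite -[p.-1%:R]/((p.-1%:R : R)) -subn1 natrB// -alphak.
  (* The surplus [(alpha - 1) * m] must cover the loss [2 * a * (p - 1) / tau]; with this [a] it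
     does, since [p ^ 2 - 2 * (p - 1) = (p - 1) ^ 2 + 1] is positive. *)
  have -> : alpha * m%:R / p%:R +
      (alpha * m%:R / p%:R - 2 * a / tau) * (p%:R - 1) =
      m%:R + m%:R * (alpha - 1) * ((p%:R - 1) ^+ 2 + 1) / p%:R ^+ 2.
    by rewrite /a; field; rewrite !gt_eqF.
  rewrite lerDl; apply: divr_ge0; last exact: exprn_ge0.
  apply: mulr_ge0; last by rewrite addr_ge0 ?sqr_ge0.
  by apply: mulr_ge0; rewrite ?subr_ge0 ltW.
apply: ler_sum => j _; apply: le_trans (tasks_done_gtB1 _ _ _).
have ea : e <= a by rewrite ge_min lexx orbT.
have /andP[_ xja] := xa j.
rewrite lerBrDr (_ : _ + 1 = (tau * k.+1%:R - 2 * a) / tau).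
  by rewrite ler_pM2r ?invr_gt0//; move: xit; lra.
by rewrite -natr1; field; rewrite gt_eqF.
Qed.

Lemma LT_latency_le_tail : (forall i, 0 <= x i) ->
  LT_latency m tau alpha x <=
    ideal_latency m tau x + \sum_(i < p) tail_part a (x i).
Proof.
move=> x0; set s := ideal_latency m tau x.
have a0 : 0 <= a.
  by rewrite divr_ge0 ?exprn_ge0// ?mulr_ge0 ?(ltW tau0) ?subr_ge0 ?(ltW alpha1).
have exc0 j : 0 <= tail_part a (x j) by exact: tail_part_ge0.
have ms : m%:R <= ideal_work tau x s by rewrite -ideal_latency_leE.
(* If no count exceeds [k] at time [s], the cap does not bind and the coded strategy is finished by
   [s] too. *)
have [/forallP sk|] :=
  boolP [forall i, (tasks_done tau (x i) s)%:~R <= k%:R :> R].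
  apply: (@le_trans _ _ s); last by rewrite lerDl sumr_ge0.
  rewrite LT_latency_leE (le_trans ms)// ler_sum// => i _.
  by rewrite le_min alphak sk lexx.
rewrite negb_forall => /existsP[i]; rewrite -ltNge => /(tasks_done_gt _ tau0) xis.
(* The single term of the largest delay will suffice. The default value 0 of the maximum is harmless
   because delays are nonnegative. *)
have [j _ maxj] := @eq_bigmax _ _ _ 0 i xpredT x isT (fun l _ => x0 l).
have xj l : x l <= x j by rewrite -maxj; exact: le_bigmax_cond.
have axj : a < x j.
  rewrite ltNge; apply/negP => xja.
  have [l|t ts mt] := ideal_work_before i s _ xis.
    by rewrite x0 (le_trans (xj l)).
  by move: ts; rewrite ltNge ideal_latency_leE mt.
apply: (le_trans (LT_latency_le _ xj)); rewrite (bigD1 j)//= tail_part_gt//.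
(* What remains is [tau * k <= s], which holds because worker [i] has already completed more than
   [k] tasks. *)
rewrite addrCA lerD2l; apply: (@le_trans _ _ s); last by rewrite lerDl sumr_ge0.
by apply: le_trans xis; rewrite ler_wpDl// ler_wpM2l ?ler_nat// ltW.
Qed.

End latency.

(** * Tail expectation and integrability of an exponential delay *)

Section exponential_tail.
Context {d : measure_display} {T : measurableType d} {R : realType}.
Variables (P : probability T R) (mu : R) (X : {RV P >-> R}).
Hypotheses (mu0 : 0 < mu) (expX : has_exponential_distribution mu X).

Lemma exponential_lt0 : P (X @^-1` `]-oo, 0[) = 0%E.
Proof.
rewrite -[LHS]/(distribution P X `]-oo, 0[) expX//.
apply: integral0_eq => x; rewrite /= in_itv/= => x0.
by rewrite lt0_exponential_pdf.
Qed.

(** No integral is computed: the value is the probability that [X] is nonnegative, the complement of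
    a null event. *)
Lemma integral_exponential_pdf_0y :
  (\int[lebesgue_measure]_(r in `[0%R, +oo[) (exponential_pdf mu r)%:E = 1)%E.
Proof.
rewrite -[LHS]/(exponential_prob mu `[0, +oo[) -expX// -setCitvl.
by rewrite probability_setC// [Y in (_ - Y)%E]exponential_lt0 sube0.
Qed.

Lemma exponential_ae_ge0 : {ae P, forall w, 0 <= X w}.
Proof.
exists (X @^-1` `]-oo, 0[); split; first exact: measurable_funPTI.
  exact: exponential_lt0.
by move=> w /= /negP; rewrite -ltNge in_itv.
Qed.

Lemma exponential_ccdf (s : R) : 0 < s -> ccdf X s = (expR (- mu * s))%:E.
Proof.
(* The null negative part is split off because [exponential_prob_itv0c] evaluates intervals that
   start at 0. *)
move=> s0; have cdfE : `]-oo, s]%classic = `]-oo, 0[ `|` `[0, s] :> set R.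
  apply/seteqP; split => x /=; rewrite !in_itv/=.
    by move=> xs; have [|] := ltP x 0; [left|right].
  by case=> [/ltW x0|/andP[]//]; rewrite (le_trans x0)// ltW.
rewrite ccdf_1_cdf /cdf cdfE measureU//; last first.
  apply/seteqP; split => x //=; rewrite !in_itv/= => -[x0 /andP[]].
  by rewrite leNgt x0.
rewrite [Y in (_ - (Y + _))%E]exponential_lt0 add0e.
rewrite [Y in (_ - Y)%E](expX _ (measurable_itv _)).
rewrite exponential_prob_itv0c// -[LHS]/((1 - (1 - expR (- mu * s)))%:E).
by rewrite subKr.
Qed.

Lemma measurable_tail_part (a : R) :
  measurable_fun [set: T] (fun w => tail_part a (X w)).
Proof.
apply: measurable_funD.
  by apply: measurable_funM => //; exact: measurableT_comp.
by apply: measurable_maxr => //; exact: measurable_funB.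
Qed.

Lemma expectation_tail_part (a : R) : 0 < a ->
  ('E_P[fun w => tail_part a (X w)] = ((a + mu^-1) * expR (- (mu * a)))%:E)%E.
Proof.
move=> a0; rewrite unlock.
have mI : measurable_fun [set: T] (fun w => \1_(`]a, +oo[ : set R) (X w) : R).
  exact: measurableT_comp.
have mM : measurable_fun [set: T] (fun w => Num.max 0 (X w - a)).
  by apply: measurable_maxr => //; apply: measurable_funB.
under eq_integral do rewrite EFinD EFinM.
rewrite ge0_integralD//; last 4 first.
- by move=> w _; rewrite lee_fin mulr_ge0// ltW.
- by apply/measurable_EFinP; apply: measurable_funM.
- by move=> w _; rewrite lee_fin le_max lexx.
- exact/measurable_EFinP.
rewrite ge0_integralZl_EFin ?(ltW a0)//; last exact/measurable_EFinP.
rewrite (_ : (\int[P]_w _)%E = ccdf X a); last first.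
  rewrite (eq_integral (fun w => (\1_(X @^-1` `]a, +oo[) w)%:E))//.
  by rewrite integral_indic ?setIT//; exact: measurable_funPTI.
rewrite exponential_ccdf//.
pose Y : {RV P >-> R} := mfun_Sub (mem_set mM).
rewrite (_ : (\int[P]_w (Num.max 0 (X w - a))%:E)%E = 'E_P[Y]%E); last first.
  by rewrite unlock.
rewrite ge0_expectation_ccdf; last by move=> w; rewrite le_max lexx.
(* Memorylessness: the tail of the excess over [a] is a constant times the exponential density, so
   its integral is that constant times the total mass 1. *)
have ccdfY r : r \in `[0, +oo[%classic ->
    ccdf Y r = ((expR (- mu * a) / mu)%:E * (exponential_pdf mu r)%:E)%E.
  rewrite inE/= in_itv/= andbT => r0; rewrite exponential_pdfE// -EFinM.
  transitivity (ccdf X (a + r)).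
    congr (P _); apply/seteqP; split => w /=; rewrite !in_itv/= !andbT.
      by rewrite lt_max ltNge r0/= ltrBrDl.
    by rewrite lt_max ltrBrDl => ->; rewrite orbT.
  rewrite exponential_ccdf ?ltr_wpDr// mulrDr expRD; congr (_%:E).
  by field; rewrite gt_eqF.
under eq_integral => r rE do rewrite (ccdfY _ rE).
rewrite ge0_integralZl_EFin//; last 3 first.
- by move=> r _; rewrite lee_fin exponential_pdf_ge0// ltW.
- apply: measurable_funTS; apply/measurable_EFinP.
  exact: measurable_exponential_pdf.
- by rewrite divr_ge0 ?expR_ge0 ?(ltW mu0).
rewrite integral_exponential_pdf_0y mule1 -EFinM -EFinD.
by congr (_%:E); rewrite mulNr; ring.
Qed.

Lemma tail_part_Lfun1 (a : R) : 0 < a ->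
  (fun w => tail_part a (X w)) \in Lfun P 1.
Proof.
move=> a0; apply/Lfun1_integrable/integrableP; split.
  exact/measurable_EFinP/measurable_tail_part.
under eq_integral do rewrite /= ger0_norm ?tail_part_ge0 ?(ltW a0)//.
by have := expectation_tail_part _ a0; rewrite unlock => ->; rewrite ltry.
Qed.

(** Almost surely [X] lies between 0 and [1 + tail_part 1 X], whose expectation is already known to
    be finite. *)
Lemma exponential_Lfun1 : (X : T -> R) \in Lfun P 1.
Proof.
have exc1 : P.-integrable [set: T] (EFin \o (fun w => 1 + tail_part 1 (X w))).
  rewrite (_ : EFin \o _ =
    ((EFin \o cst 1%R) \+ (EFin \o (fun w => tail_part 1%R (X w))))%E)//.
  by apply: integrableD => //; apply/Lfun1_integrable;
    [exact: Lfun_cst|exact: tail_part_Lfun1].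
apply/Lfun1_integrable/integrableP; split; first exact/measurable_EFinP.
have /integrableP[_] := exc1; apply: le_lt_trans.
apply: ae_ge0_le_integral => //.
- by apply/measurable_EFinP; exact: measurableT_comp.
- apply/measurable_EFinP; apply: measurableT_comp => //.
  by apply: measurable_funD => //; exact: measurable_tail_part.
- apply: filterS exponential_ae_ge0 => w Xw0 _ /=.
  have e0 : 0 <= tail_part 1 (X w) by exact: tail_part_ge0.
  rewrite lee_fin (ger0_norm Xw0) ger0_norm ?(addr_ge0 ler01 e0)//.
  have [X1|X1] := ltP 1 (X w); first by rewrite tail_part_gt// lerDr.
  by rewrite (le_trans X1)// lerDl.
Qed.

End exponential_tail.

(** * Measurability and integrability of the latencies *)

Lemma measurable_fun_le_set {d : measure_display} {T : measurableType d}
    {R : realType} (f : T -> R) :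
  (forall t, measurable [set w | f w <= t]) -> measurable_fun [set: T] f.
Proof.
move=> mf mT; apply: (measurability _ (RGenOInfty.measurableE R)) => //.
move=> /= _ [_ [t ->] <-]; apply: measurableI => //.
rewrite (_ : _ @^-1` _ = ~` [set w | f w <= t]); first exact: measurableC.
by apply/seteqP; split => w /=; rewrite in_itv/= andbT ltNge => /negP.
Qed.

Section measurable_latency.
Context {d : measure_display} {T : measurableType d} {R : realType}.
Variables (P : probability T R) (p m : nat) (tau alpha : R).
Variable X : 'I_p -> {RV P >-> R}.
Hypotheses (p0 : (0 < p)%N) (m0 : (0 < m)%N) (tau0 : 0 < tau).
Hypothesis alpha1 : 1 < alpha.

Let mtasks i t :
  measurable_fun [set: T] (fun w => (tasks_done tau (X i w) t)%:~R : R).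
Proof. exact: (measurableT_comp (measurable_tasks_done _ tau0 t)). Qed.

(** Sublevel sets of the latency are events about the work at a fixed time, a finite sum of
    measurable counts. *)
Lemma measurable_ideal_latency :
  measurable_fun [set: T] (fun w => ideal_latency m tau (fun i => X i w)).
Proof.
apply: measurable_fun_le_set => t.
rewrite (_ : [set w | _] =
  [set w | m%:R <= ideal_work tau (X ^~ w) t]); last first.
  by apply/seteqP; split => w /=; rewrite ideal_latency_leE.
have mw : measurable_fun [set: T] (fun w => ideal_work tau (X ^~ w) t).
  exact: measurable_sum.
have := mw measurableT `[m%:R, +oo[%classic (measurable_itv _).
by rewrite setTI preimage_itvcy.
Qed.

Lemma measurable_LT_latency :
  measurable_fun [set: T] (fun w => LT_latency m tau alpha (fun i => X i w)).
Proof.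
apply: measurable_fun_le_set => t.
rewrite (_ : [set w | _] =
  [set w | m%:R <= LT_work m tau alpha (X ^~ w) t]); last first.
  by apply/seteqP; split => w /=; rewrite LT_latency_leE.
have mw : measurable_fun [set: T] (fun w => LT_work m tau alpha (X ^~ w) t).
  by apply: measurable_sum => i; exact: measurable_minr.
have := mw measurableT `[m%:R, +oo[%classic (measurable_itv _).
by rewrite setTI preimage_itvcy.
Qed.

End measurable_latency.

Lemma dominated_Lfun1 {d : measure_display} {T : measurableType d}
    {R : realType} (P : probability T R) (I : finType) (X : I -> T -> R) (c : R)
    (f : T -> R) :
  (forall i, X i \in Lfun P 1) -> measurable_fun [set: T] f ->
  (forall w, `|f w| <= \sum_i `|X i w| + c) -> f \in Lfun P 1.
Proof.
move=> LX mf fX; apply/Lfun1_integrable.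
pose g w := (\sum_i `|(X i w)%:E| + c%:E)%E.
apply: (@le_integrable _ _ _ P _ measurableT _ g); first exact/measurable_EFinP.
  move=> w _; rewrite /g sumEFin -EFinD !abse_EFin lee_fin.
  by rewrite (le_trans (fX w))// ler_norm.
apply: integrableD => //; last exact/Lfun1_integrable/Lfun_cst.
apply: integrable_sum => // i _; apply: integrable_abse.
exact/Lfun1_integrable.
Qed.

(** * The bound in expectation *)

Lemma expectation_sum_tail_part {d : measure_display} {T : measurableType d}
    {R : realType} (P : probability T R) (p : nat) (mu a : R)
    (X : 'I_p -> {RV P >-> R}) : 0 < mu -> 0 < a ->
  (forall i, has_exponential_distribution mu (X i)) ->
  ('E_P[fun w => (\sum_(i < p) tail_part a (X i w))%R] =
   (p%:R * ((a + mu^-1) * expR (- (mu * a))))%:E)%E.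
Proof.
move=> mu0 a0 expX; rewrite unlock.
under eq_integral do rewrite -sumEFin.
rewrite ge0_integral_sum//; last 2 first.
- by move=> i; apply/measurable_EFinP; exact: measurable_tail_part.
- by move=> i w _; rewrite lee_fin tail_part_ge0// ltW.
under eq_bigr => i _.
  have := expectation_tail_part _ _ _ mu0 (expX i) _ a0; rewrite unlock => ->.
  over.
by rewrite sumEFin sumr_const card_ord mulr_natl.
Qed.

Theorem theorem4 (R : realType) (d : measure_display) (T : measurableType d)
    (P : probability T R) (p m : nat) (tau mu alpha : R)
    (X : 'I_p -> {RV P >-> R}) :
  (2 <= p)%N -> (1 <= m)%N -> 0 < tau -> 0 < mu -> 1 < alpha ->
  alpha * m%:R / p%:R \is a Num.int ->
  mutually_independent X ->
  (forall i, has_exponential_distribution mu (X i)) ->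
  ('E_P[fun w => LT_latency m tau alpha (fun i => X i w)]
     - 'E_P[fun w => ideal_latency m tau (fun i => X i w)]
   <= ((tau * alpha * m%:R * p%:R ^+ 2 + p%:R ^+ 2 / mu + tau * p%:R)
       * expR (- (mu * tau * m%:R * (alpha - 1) / p%:R ^+ 2)))%:E)%E.
Proof.
move=> /ltnW p0 m0 tau0 mu0 alpha1 cint _ expX.
have pR1 : 1 <= p%:R :> R by rewrite ler1n.
have pR : 0 < p%:R :> R by rewrite ltr0n.
have mR : 0 < m%:R :> R by rewrite ltr0n.
have [k alphak] : exists k : nat, alpha * m%:R / p%:R = k%:R.
  apply/natrP; rewrite natrEint cint divr_ge0 ?mulr_ge0//.
  by rewrite (le_trans ler01)// ltW.
(* Delays are nonnegative only almost surely, whereas [dominated_Lfun1] asks for a bound at every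
   [w]; hence the absolute values. *)
have Xabs w i : - (\sum_j `|X j w|) <= X i w <= \sum_j `|X j w|.
  by rewrite -ler_norml (bigD1 i)//= lerDl sumr_ge0.
have lo w : - (\sum_j `|X j w|) <= ideal_latency m tau (X ^~ w).
  by apply: ideal_latency_ge => // i; have /andP[] := Xabs w i.
have il w : ideal_latency m tau (X ^~ w) <= LT_latency m tau alpha (X ^~ w).
  exact: ideal_le_LT_latency.
have hi w :
    LT_latency m tau alpha (X ^~ w) <= \sum_j `|X j w| + tau * k%:R.
  by apply: LT_latency_le => // i; have /andP[] := Xabs w i.
have lok w : - (\sum_j `|X j w| + tau * k%:R) <= ideal_latency m tau (X ^~ w).
  by rewrite (le_trans _ (lo w))// lerN2 lerDl mulr_ge0// ltW.
have LX i : (X i : T -> R) \in Lfun P 1 := exponential_Lfun1 _ _ _ mu0 (expX i).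
have mI := measurable_ideal_latency _ _ _ _ X p0 m0 tau0.
have mL := measurable_LT_latency _ _ _ _ _ X p0 m0 tau0 alpha1.
(* Merging the two extended-real expectations requires both latencies to be integrable. *)
rewrite -expectationB; last 2 first.
- apply: (dominated_Lfun1 _ _ _ (tau * k%:R) _ LX mL) => w.
  by rewrite ler_norml hi (le_trans (lok w)).
- apply: (dominated_Lfun1 _ _ _ (tau * k%:R) _ LX mI) => w.
  by rewrite ler_norml lok (le_trans (il w)).
pose a := tau * m%:R * (alpha - 1) / p%:R ^+ 2.
have a0 : 0 < a by rewrite divr_gt0 ?exprn_gt0 ?mulr_gt0 ?subr_gt0.
apply: (@le_trans _ _ 'E_P[fun w => (\sum_(i < p) tail_part a (X i w))%R]%E).
  apply: expectation_le.
  - exact: measurable_funB.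
  - by apply: measurable_sum => i; exact: measurable_tail_part.
  - by move=> w; rewrite subr_ge0.
  - by move=> w; apply: sumr_ge0 => i _; exact/tail_part_ge0/ltW.
  - have : {ae P, forall w, forall i, 0 <= X i w}.
      by apply: filter_forall => i; exact: exponential_ae_ge0 (expX i).
    apply: filterS => w Xw0 /=; rewrite lerBlDl.
    exact: (LT_latency_le_tail _ _ k).
rewrite (expectation_sum_tail_part _ _ mu)// lee_fin mulrA.
rewrite (_ : mu * a = mu * tau * m%:R * (alpha - 1) / p%:R ^+ 2); last first.
  by rewrite /a; field; rewrite gt_eqF.
apply: ler_wpM2r; first exact: expR_ge0.
(* Termwise comparison: [p * a] with [tau * alpha * m * p ^ 2], [p / mu] with [p ^ 2 / mu], and 0
   with [tau * p]. *)
rewrite mulrDr -[leLHS]addr0; apply: lerD; last by rewrite mulr_ge0 ?(ltW tau0).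
apply: lerD.
  rewrite (_ : p%:R * a = tau * (alpha - 1) * m%:R / p%:R); last first.
    by rewrite /a; field; rewrite gt_eqF.
  have tam0 : 0 <= tau * alpha * m%:R.
    by rewrite !mulr_ge0 ?(ltW tau0)// (le_trans ler01)// ltW.
  apply: (@le_trans _ _ (tau * alpha * m%:R)); last first.
    by rewrite ler_peMr// exprn_ege1.
  rewrite ler_pdivrMr//; apply: (@le_trans _ _ (tau * alpha * m%:R)).
    by rewrite ler_pM2r// ler_pM2l// gerBl.
  by rewrite ler_peMr.
rewrite ler_wpM2r ?invr_ge0 ?(ltW mu0)//.
by rewrite expr2 ler_peMl// ltW.
Qed.
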